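(* Let $n\ge 3$ and let $Q^+(2n+1,2)$ be a non-degenerate hyperbolic quadric of ${\rm PG}(2n+1,2)$. Let $NO^+(2n+2,2)$ be the graph with vertex set ${\rm PG}(2n+1,2)\setminus Q^+(2n+1,2)$, two vertices adjacent iff the line joining them is tangent to $Q^+(2n+1,2)$. Fix a generator $\Pi$ of $Q^+(2n+1,2)$ and let $\mathcal G_n$ be the graph with vertex set $Q^+(2n+1,2)\setminus\Pi$, two distinct vertices $P_1,P_2$ adjacent iff either the line $\langle P_1,P_2\rangle$ is secant to $Q^+(2n+1,2)$, or it is contained in $Q^+(2n+1,2)$ and meets $\Pi$ in a point. Then $\mathcal G_n$ and $NO^+(2n+2,2)$ are not isomorphic.
   Context: A generator of $Q^+(2n+1,2)$ is an $n$-dimensional projective subspace contained in the quadric. A tangent line is a line meeting the quadric in exactly one point. *)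

(* Defs.v *)
From HB Require Import structures.
From mathcomp Require Import all_boot all_order all_algebra.
Set Implicit Arguments.
Unset Strict Implicit.
Unset Printing Implicit Defensive.

Import GRing.Theory.
Local Open Scope ring_scope.

Record sgraph := SGraph {
  vertex : Type;
  adj : vertex -> vertex -> Prop;
  adj_sym : forall x y, adj x y -> adj y x;
  adj_irrefl : forall x, ~ adj x x
}.

Definition graph_isomorphic (G H : sgraph) : Prop :=
  exists f : vertex G -> vertex H,
    bijective f /\ forall x y, adj x y <-> adj (f x) (f y).

Section Quadrics.
Variables (K : finFieldType) (m : nat).
Local Notation V := 'rV[K]_m.
Implicit Types (Q : V -> K) (P L U : {vspace V}).

(* PG(m - 1, K): projective subspaces are vector subspaces of V, so vector
   dimensions exceed projective dimensions by one; the line joining two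
   distinct points P and R is (P + R)%VS. *)
Definition is_point P : bool := \dim P == 1%N.
Definition is_line L : bool := \dim L == 2%N.

Definition polar Q (u v : V) : K := Q (u + v) - Q u - Q v.

Definition quadratic_form Q : Prop :=
  [/\ forall a v, Q (a *: v) = a ^+ 2 * Q v,
      forall u, scalar (polar Q u)
    & forall v, scalar (polar Q ^~ v)].

(* The quadric has no singular point. In characteristic 2 this is weaker in
   general than non-degeneracy of the polar form; over a finite field the two
   agree when m is even. *)
Definition nondegenerate Q : Prop :=
  forall v, Q v = 0 -> (forall u, polar Q u v = 0) -> v = 0.

Definition quadric Q : {pred {vspace V}} :=
  [pred P | is_point P && [forall v, (v \in P) ==> (Q v == 0)]].

Definition contained Q U : Prop :=
  forall P, is_point P -> (P <= U)%VS -> P \in quadric Q.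

Definition witt_index Q (r : nat) : Prop :=
  (exists2 U, contained Q U & \dim U = r) /\
  (forall U, contained Q U -> (\dim U <= r)%N).

Definition tangent Q L : Prop :=
  is_line L /\ exists P, forall S, (S \in quadric Q) && (S <= L)%VS <-> S = P.

Definition secant Q L : Prop :=
  is_line L /\ exists P R, P <> R /\
    forall S, (S \in quadric Q) && (S <= L)%VS <-> S = P \/ S = R.

Definition NO_vertex Q : Type :=
  {P : {vspace V} | is_point P && (P \notin quadric Q)}.

Definition NO_adj Q (x y : NO_vertex Q) : Prop :=
  x <> y /\ tangent Q (val x + val y)%VS.

Lemma NO_adj_sym Q (x y : NO_vertex Q) : NO_adj x y -> NO_adj y x.
Proof. by case=> xy t; split; [move=> yx; apply: xy | rewrite addvC]. Qed.

Lemma NO_adj_irrefl Q (x : NO_vertex Q) : ~ NO_adj x x.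
Proof. by case. Qed.

Definition NO_graph Q : sgraph :=
  SGraph (@NO_adj_sym Q) (@NO_adj_irrefl Q).

Definition G_vertex Q (Pi : {vspace V}) : Type :=
  {P : {vspace V} | (P \in quadric Q) && ~~ (P <= Pi)%VS}.

Definition G_adj Q Pi (x y : G_vertex Q Pi) : Prop :=
  x <> y /\
  let L := (val x + val y)%VS in
  secant Q L \/ (contained Q L /\ is_point (L :&: Pi)%VS).

Lemma G_adj_sym Q Pi (x y : G_vertex Q Pi) : G_adj x y -> G_adj y x.
Proof.
by case=> xy t; split; [move=> yx; apply: xy | rewrite /= addvC].
Qed.

Lemma G_adj_irrefl Q Pi (x : G_vertex Q Pi) : ~ G_adj x x.
Proof. by case. Qed.

Definition G_graph Q Pi : sgraph :=
  SGraph (@G_adj_sym Q Pi) (@G_adj_irrefl Q Pi).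

End Quadrics.

(* Q^+(2n+1, q): non-degenerate, with generators of projective dimension n. *)
Definition hyperbolic_form (K : finFieldType) (n : nat)
    (Q : 'rV[K]_(2 * n + 2) -> K) : Prop :=
  [/\ quadratic_form Q, nondegenerate Q & witt_index Q n.+1].

Definition generator (K : finFieldType) (n : nat)
    (Q : 'rV[K]_(2 * n + 2) -> K) (Pi : {vspace 'rV[K]_(2 * n + 2)}) : Prop :=
  \dim Pi = n.+1 /\ contained Q Pi.

(* Main.v *)
(* Identify points with nonzero vectors over F_2, let B be the polar form of Q
   and W the totally singular space of the generator. Adjacency in NO^+ is
   B(u, v) = 0; adjacency in G_n of points in distinct cosets of W is
   B(u, v) = 1. In NO^+, for a triangle x, y, z the vertex t = x + y + z is such
   that every further vertex is adjacent to an even number of x, y, z, t, since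
   B(v, x) + B(v, y) + B(v, z) + B(v, t) = 0. In G_n some triangles p, q, r have
   no such t: take them singular, in distinct cosets of W, with all polar values
   1. Then Q(p + q + r) = 1, so s = p + q + r + t is nonzero for each singular t,
   and as n >= 3 there is room for a singular v with B(v, s) = 1 outside W and
   outside the cosets of p, q, r, t; it is adjacent to an odd number of them. *)
Require Import Defs.
From mathcomp Require Import all_boot all_order all_algebra.
From mathcomp Require Import zify.
Set Implicit Arguments.
Unset Strict Implicit.
Unset Printing Implicit Defensive.

Import GRing.Theory.
Local Open Scope ring_scope.

(** * Arithmetic over ['F_2] *)

Lemma F2P (a : 'F_2) : a = 0 \/ a = 1.
Proof. by case: a => [[|[|//]] lt_a2]; [left | right]; apply/val_inj. Qed.

Lemma F2_neq0 (a : 'F_2) : a != 0 -> a = 1.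
Proof. by case: (F2P a) => ->; rewrite ?eqxx. Qed.

Lemma F2_addxx (a : 'F_2) : a + a = 0.
Proof. by case: (F2P a) => ->; apply/val_inj. Qed.

(** Adding [e] to all four terms leaves the sum unchanged, so either value may stand for adjacency:
    [0] serves for tangent lines, [1] for secant ones. *)
Lemma F2_parity (a b c d e : 'F_2) :
  a + b + c + d = 0 <-> ((a = e <-> b = e) <-> (c = e <-> d = e)).
Proof.
have n10 : (1 : 'F_2) <> 0 by [].
have n01 : (0 : 'F_2) <> 1 by [].
case: (F2P a) (F2P b) (F2P c) (F2P d) (F2P e) => -> [] -> [] -> [] -> [] ->;
by rewrite ?addr0 ?add0r ?F2_addxx ?addr0 ?add0r ?F2_addxx; tauto.
Qed.

Lemma addrr_F2 k (v : 'rV['F_2]_k) : v + v = 0.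
Proof. by apply/rowP=> i; rewrite !mxE F2_addxx. Qed.

Lemma addrK_F2 k (u v : 'rV['F_2]_k) : u + v + v = u.
Proof. by rewrite -addrA addrr_F2 addr0. Qed.

Lemma addr_eq0_F2 k (u v : 'rV['F_2]_k) : (u + v == 0) = (u == v).
Proof. by rewrite -(inj_eq (addIr v)) addrK_F2 add0r. Qed.

(** * Points and lines over ['F_2] *)

Section PointsF2.
Variable k : nat.
Local Notation V := 'rV['F_2]_k.
Implicit Types (u v w : V) (P L : {vspace V}).

Lemma mem_vline_F2 w v : (w \in <[v]>%VS) = (w == 0) || (w == v).
Proof.
apply/vlineP/orP=> [[a ->]|[]/eqP->]; last 2 first.
- by exists 0; rewrite scale0r.
- by exists 1; rewrite scale1r.
by case: (F2P a) => ->; rewrite ?scale0r ?scale1r eqxx; [left | right].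
Qed.

Lemma vline_inj_F2 u v : v != 0 -> <[u]>%VS = <[v]>%VS -> u = v.
Proof.
move=> v0 uv; have := memv_line v; rewrite -uv mem_vline_F2 (negPf v0) /=.
by move/eqP.
Qed.

Lemma is_point_vline v : is_point <[v]>%VS = (v != 0).
Proof. by rewrite /is_point dim_vline; case: (v == 0). Qed.

Lemma is_point_vpick P : is_point P -> vpick P != 0 /\ P = <[vpick P]>%VS.
Proof.
move=> Ppt; have P0 : vpick P != 0.
  by rewrite vpick0 -dimv_eq0 (eqP Ppt).
split=> //; apply/esym/eqP; rewrite eqEdim -memvE memv_pick /=.
by rewrite dim_vline P0 (eqP Ppt).
Qed.

Lemma mem_line_F2 u v w :
  (w \in <[u]> + <[v]>)%VS = [|| w == 0, w == u, w == v | w == u + v].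
Proof.
apply/memv_addP/idP=> [[a au [b bv ->]]|].
  move: au bv; rewrite !mem_vline_F2 => /orP[]/eqP-> /orP[]/eqP->;
  by rewrite ?addr0 ?add0r eqxx ?orbT.
case/or4P=> /eqP->.
- by exists 0; rewrite ?mem0v //; exists 0; rewrite ?mem0v ?addr0.
- by exists u; rewrite ?memv_line //; exists 0; rewrite ?mem0v ?addr0.
- by exists 0; rewrite ?mem0v //; exists v; rewrite ?memv_line ?add0r.
- by exists u; rewrite ?memv_line //; exists v; rewrite ?memv_line.
Qed.

Lemma is_line_add u v : u != 0 -> v != 0 -> u != v -> is_line (<[u]> + <[v]>)%VS.
Proof.
move=> u0 v0 uv; rewrite /is_line dimv_disjoint_sum ?dim_vline ?u0 ?v0 //.
apply/eqP; rewrite -subv0; apply/subvP=> w /memv_capP[].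
rewrite memv0 !mem_vline_F2 => /orP[->//|/eqP->] /orP[//|/eqP uv'].
by rewrite uv' eqxx in uv.
Qed.

(** * The quadratic form, its polar form and the types of lines *)

Variable Q : V -> 'F_2.
Hypothesis quadQ : quadratic_form Q.
Local Notation B := (polar Q).

Lemma quad0 : Q 0 = 0.
Proof. by case: quadQ => + _ _ => /(_ 0 0); rewrite scale0r expr0n mul0r. Qed.

Lemma quadric_vline v : (<[v]>%VS \in quadric Q) = (v != 0) && (Q v == 0).
Proof.
rewrite inE is_point_vline; congr (_ && _); apply/forallP/idP=> [/(_ v)|Qv w].
  by rewrite memv_line.
by apply/implyP; rewrite mem_vline_F2 => /orP[]/eqP->//; rewrite quad0.
Qed.

Lemma quadD u v : Q (u + v) = Q u + Q v + B u v.
Proof. by rewrite /polar -[Q _ - Q u - _]addrA -opprD [RHS]addrC subrK. Qed.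

Lemma polarC u v : B u v = B v u.
Proof. by rewrite /polar (addrC u) addrAC. Qed.

Lemma polarDr u v w : B u (v + w) = B u v + B u w.
Proof. by case: quadQ => _ /(_ u 1 v w) + _; rewrite scale1r mul1r. Qed.

Lemma polarZr a u v : B u (a *: v) = a * B u v.
Proof.
case: quadQ => _ lin _; have := lin u a v 0; rewrite addr0 => ->.
have := lin u 1 0 0; rewrite scale1r addr0 mul1r => /esym/eqP.
by rewrite -subr_eq0 addrK => /eqP->; rewrite addr0.
Qed.

Lemma polar0r u : B u 0 = 0.
Proof. by rewrite -(scale0r 0) polarZr mul0r. Qed.

Lemma polarDl u v w : B (u + v) w = B u w + B v w.
Proof. by rewrite polarC polarDr !(polarC w). Qed.

Lemma polar_sumr (I : Type) (r : seq I) (F : I -> V) u :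
  B u (\sum_(i <- r) F i) = \sum_(i <- r) B u (F i).
Proof.
elim: r => [|i r IH]; first by rewrite !big_nil polar0r.
by rewrite !big_cons polarDr IH.
Qed.

(** The points of the line are [u], [v], [u + v], and only the third can be singular, since
    [Q (u + v) = 1 + 1 + B u v]. *)
Lemma tangent_line u v : u != v -> Q u = 1 -> Q v = 1 ->
  tangent Q (<[u]> + <[v]>)%VS <-> B u v = 0.
Proof.
move=> uv Qu Qv.
have u0 : u != 0 by apply: contra_eq_neq Qu => ->; rewrite quad0.
have v0 : v != 0 by apply: contra_eq_neq Qv => ->; rewrite quad0.
have Quv : Q (u + v) = B u v by rewrite quadD Qu Qv F2_addxx add0r.
have uv0 : u + v != 0 by rewrite addr_eq0_F2.
have singular S : (S \in quadric Q) && (S <= <[u]> + <[v]>)%VS ->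
    S = <[u + v]>%VS /\ Q (u + v) = 0.
  case/andP=> QS; have /andP[/is_point_vpick[S0 SE] _] := QS.
  move: QS; rewrite SE quadric_vline -memvE mem_line_F2 (negPf S0) /=.
  by move=> /eqP QS /or3P[]/eqP E; move: QS; rewrite E ?Qu ?Qv.
split=> [[_ [P /(_ P)[_ /(_ erefl)/singular[_]]]]|B0]; first by rewrite Quv.
split; first exact: is_line_add.
exists <[u + v]>%VS => S; split=> [/singular[]//|->].
by rewrite quadric_vline uv0 Quv B0 eqxx -memvE mem_line_F2 eqxx !orbT.
Qed.

(** The third point decides: [Q (u + v) = B u v], and when this is [0] the line carries three
    singular points instead of two. *)
Lemma secant_line u v : u != 0 -> v != 0 -> u != v -> Q u = 0 -> Q v = 0 ->
  secant Q (<[u]> + <[v]>)%VS <-> B u v = 1.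
Proof.
move=> u0 v0 uv Qu Qv.
have Quv : Q (u + v) = B u v by rewrite quadD Qu Qv !add0r.
have uv0 : u + v != 0 by rewrite addr_eq0_F2.
have mem w : w \in [:: u; v; u + v] -> Q w = 0 ->
    (<[w]>%VS \in quadric Q) && (<[w]> <= <[u]> + <[v]>)%VS.
  rewrite quadric_vline -memvE mem_line_F2 !inE => wE ->.
  by rewrite wE orbT eqxx andbT andbT; case/or3P: wE => /eqP->.
split=> [[_ [P [R [_ PR]]]]|B1].
  have [Quv0|->] := F2P (B u v); last by [].
  have [uPR _] := PR <[u]>%VS.
  have [vPR _] := PR <[v]>%VS.
  have [wPR _] := PR <[u + v]>%VS.
  have := uPR (mem u _ Qu); have := vPR (mem v _ Qv).
  have := wPR (mem (u + v) _ (etrans Quv Quv0)).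
  rewrite !inE !eqxx !orbT => /(_ isT) w3 /(_ isT) w2 /(_ isT) w1.
  have nuv : <[u]>%VS <> <[v]>%VS by move/(vline_inj_F2 v0)/eqP; apply/negP.
  have nuw : <[u]>%VS <> <[u + v]>%VS.
    move/(vline_inj_F2 uv0)/eqP; rewrite -{1}[u]addr0 (inj_eq (addrI u)).
    by rewrite eq_sym (negPf v0).
  have nvw : <[v]>%VS <> <[u + v]>%VS.
    move/(vline_inj_F2 uv0)/eqP; rewrite -{1}[v]add0r (inj_eq (addIr v)).
    by rewrite eq_sym (negPf u0).
  by case: w1 w2 w3 => w1 [] w2 [] w3; congruence.
split; first exact: is_line_add.
exists <[u]>%VS, <[v]>%VS; split; first by move/(vline_inj_F2 v0)/eqP; apply/negP.
move=> S; split=> [/andP[QS]|[]->]; last 2 first.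
- by apply: mem; rewrite ?inE ?eqxx.
- by apply: mem; rewrite ?inE ?eqxx ?orbT.
have /andP[/is_point_vpick[S0 SE] _] := QS.
move: QS; rewrite SE quadric_vline -memvE mem_line_F2 (negPf S0) /=.
move=> /eqP QS /or3P[]/eqP E; [by left; rewrite E|by right; rewrite E|].
by move: QS; rewrite E Quv B1.
Qed.

Lemma line_cap_point u v (W : {vspace V}) : u != v -> u \notin W -> v \notin W ->
  is_point ((<[u]> + <[v]>) :&: W)%VS = (u + v \in W).
Proof.
move=> uv uW vW; have uv0 : u + v != 0 by rewrite addr_eq0_F2.
apply/idP/idP=> [/is_point_vpick[]|uvW].
  have /memv_capP[] := memv_pick ((<[u]> + <[v]>) :&: W)%VS.
  set w := vpick _ => + wW /negPf w0 _.
  rewrite mem_line_F2 w0 /= => /or3P[]/eqP E; last by rewrite -E.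
    by rewrite -E wW in uW.
  by rewrite -E wW in vW.
suff -> : ((<[u]> + <[v]>) :&: W)%VS = <[u + v]>%VS by rewrite is_point_vline.
apply/vspaceP=> w; rewrite memv_cap mem_line_F2 mem_vline_F2.
apply/andP/orP=> [[/or4P[]/eqP-> wW]|[]/eqP->].
- by left.
- by rewrite wW in uW.
- by rewrite wW in vW.
- by right.
- by rewrite eqxx mem0v.
- by rewrite eqxx !orbT.
Qed.

Lemma contained_quad (W : {vspace V}) v : contained Q W -> v \in W -> Q v = 0.
Proof.
have [-> _ _|v0 cW vW] := eqVneq v 0; first exact: quad0.
have := cW <[v]>%VS; rewrite is_point_vline quadric_vline v0 -memvE.
by move=> /(_ isT vW)/eqP.
Qed.

Lemma contained_polar (W : {vspace V}) u v :
  contained Q W -> u \in W -> v \in W -> B u v = 0.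
Proof.
move=> cW uW vW; have Q0 := contained_quad cW.
by have := quadD u v; rewrite !Q0 ?memvD // !add0r => <-.
Qed.


Lemma polar_delta u v : B u v = \sum_i u 0 i * B (delta_mx 0 i) v.
Proof.
rewrite {1}[u]row_sum_delta polarC polar_sumr.
by apply: eq_bigr => i _; rewrite polarZr polarC.
Qed.

Lemma coord_vbasis_F2 (W : {vspace V}) v : v \in W ->
  exists x : 'rV['F_2]_(\dim W), v = \sum_i x 0 i *: (vbasis W)`_i.
Proof.
move=> vW; exists (\row_i coord (vbasis W) i v).
by rewrite {1}(coord_vbasis vW); apply: eq_bigr => i _; rewrite mxE.
Qed.

(** * Totally singular subspaces of half the dimension *)

Hypothesis ndQ : Defs.nondegenerate Q.
Variable W : {vspace V}.
Hypotheses (cW : contained Q W) (dimW : k = (\dim W).*2).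

(** The rows of [M] span [W], and [kermx N] is the space orthogonal to [W]; the former lies in the
    latter, and the ranks agree because [k] is twice [\dim W]. *)
Lemma perp_generator z : (forall w, w \in W -> B z w = 0) -> z \in W.
Proof.
move=> zW; pose b (j : 'I_(\dim W)) : V := (vbasis W)`_j.
have bW j : b j \in W by apply/vbasis_mem/mem_nth; rewrite size_tuple.
pose M : 'M['F_2]_(\dim W, k) := \matrix_j b j.
pose N : 'M['F_2]_(k, \dim W) := \matrix_(i, j) B (delta_mx 0 i) (b j).
have mulM (x : 'rV_(\dim W)) : x *m M = \sum_j x 0 j *: b j.
  by rewrite mulmx_sum_row; apply: eq_bigr => j _; rewrite rowK.
have mulN (v : V) j : (v *m N) 0 j = B v (b j).
  by rewrite mxE polar_delta; apply: eq_bigr => i _; rewrite mxE.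
have freeM : row_free M.
  apply/inj_row_free => x; rewrite mulM => x0; apply/rowP=> j; rewrite mxE.
  exact: (freeP (basis_free (vbasisP W)) (fun j => x 0 j) x0).
(* A row [x] killed by the transpose of [N] gives a vector [x *m M] of [W] in the radical; being
   singular, it is zero by [ndQ]. *)
have rankN : \rank N = \dim W.
  rewrite -mxrank_tr; apply/eqP/inj_row_free => x xN.
  suff xM0 : x *m M = 0 by apply: (row_free_inj freeM); rewrite xM0 mul0mx.
  have xMW : x *m M \in W.
    by rewrite mulM; apply: memv_suml => j _; apply: memvZ.
  apply: ndQ => [|u]; first exact: (contained_quad cW xMW).
  rewrite polar_delta big1 // => i _; move/rowP/(_ i): xN.
  rewrite !mxE mulM polar_sumr => xN; rewrite [X in _ * X](_ : _ = 0) ?mulr0 //.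
  by rewrite -[RHS]xN; apply: eq_bigr => j _; rewrite polarZr !mxE.
have MN : (M <= kermx N)%MS.
  apply/sub_kermxP/row_matrixP => j; rewrite row_mul rowK row0.
  by apply/rowP=> l; rewrite mulN mxE (contained_polar cW).
have kerM : (kermx N <= M)%MS.
  rewrite -(geq_leqif (mxrank_leqif_sup MN)) mxrank_ker rankN (eqP freeM).
  by rewrite [X in (X - _)%N]dimW -addnn addnK.
have /submxP[x ->] : (z <= M)%MS.
  apply: submx_trans kerM; apply/sub_kermxP/rowP=> j.
  by rewrite mulN mxE zW.
by rewrite mulM; apply: memv_suml => j _; apply: memvZ.
Qed.

(** [ndQ] covers singular vectors only; a radical vector is orthogonal to [W], hence in [W], hence
    singular. *)
Lemma polar_nondegenerate v : (forall u, B u v = 0) -> v = 0.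
Proof.
move=> v0; have vW : v \in W by apply: perp_generator => w _; rewrite polarC.
by apply: ndQ => //; apply: contained_quad cW vW.
Qed.

(** Every linear form on [V] is [B _ y] for some [y], so a form that vanishes on [X] but not at [z]
    suffices. *)
Lemma polar_separation (X : {vspace V}) z : z \notin X ->
  exists2 y, (forall x, x \in X -> B x y = 0) & B z y = 1.
Proof.
move=> zX; pose T y : V := \row_i B (delta_mx 0 i) y.
(* [T y] lists the values of [B _ y] on the standard basis; injective on a finite set, [T] reaches
   every form. *)
have T_inj : injective T.
  move=> y1 y2 /rowP eqT; apply/eqP; rewrite -addr_eq0_F2; apply/eqP.
  apply: polar_nondegenerate => u; rewrite polar_delta big1 // => i _.
  by have := eqT i; rewrite !mxE polarDr => ->; rewrite F2_addxx mulr0.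
have [T' _ TK] := injF_bij T_inj.
(* [g] kills [X] but not [z], so one of its coordinates is the required form. *)
pose g : 'End(V) := (\1 - projv X)%VF.
have gE v : g v = v - projv X v by rewrite add_lfunE opp_lfunE id_lfunE.
have /rV0Pn[i gzi] : g z != 0.
  by rewrite gE subr_eq0; apply: contraNneq zX => ->; apply: memv_proj.
have BT v : B v (T' (\row_j g (delta_mx 0 j) 0 i)) = g v 0 i.
  set y := T' _; have /rowP yE : T y = \row_j g (delta_mx 0 j) 0 i by apply: TK.
  rewrite polar_delta [in RHS](row_sum_delta v) linear_sum summxE.
  by apply: eq_bigr => j _; have := yE j; rewrite !mxE => ->; rewrite linearZ mxE.
exists (T' (\row_j g (delta_mx 0 j) 0 i)) => [x xX|]; rewrite BT.
  by rewrite gE projv_id // subrr mxE.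
exact: F2_neq0.
Qed.

(** A vector orthogonal to [W + U] lies in [W], which is its own orthogonal space. *)
Lemma perp_separation (U : {vspace V}) z : z \notin (W + U)%VS ->
  exists w, [/\ w \in W, forall u, u \in U -> B u w = 0 & B z w = 1].
Proof.
case/polar_separation=> w perp_w zw; exists w; split=> //.
  by apply: perp_generator => x xW; rewrite polarC perp_w // (subvP (addvSl W U)).
by move=> u uU; rewrite perp_w // (subvP (addvSr W U)).
Qed.

(** If [Q z = 1], adding some [w] in [W] with [B z w = 1] cancels this value; the coset of [z] and
    its polar values against [U] persist. *)
Lemma singular_translate (U : {vspace V}) z : z \notin (W + U)%VS ->
  exists w, [/\ w \in W, forall u, u \in U -> B u w = 0 & Q (z + w) = 0].
Proof.
move=> zWU; have [Qz|Qz] := F2P (Q z).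
  exists 0; split=> [|u _|]; [exact: mem0v | exact: polar0r | by rewrite addr0].
have [w [wW perp_w zw]] := perp_separation zWU; exists w; split=> //.
by rewrite quadD Qz (contained_quad cW wW) zw addr0 F2_addxx.
Qed.

(** * Cosets of [W] and a triangle of singular vectors *)

Lemma memv_addl (X : {vspace V}) u v : v \in X -> (u + v \in X) = (u \in X).
Proof. by move=> vX; rewrite rpredDr. Qed.

Lemma memv_add_vline (X : {vspace V}) u v :
  (u \in X + <[v]>)%VS = (u \in X) || (u + v \in X).
Proof.
apply/memv_addP/orP=> [[x xX [y]]|[uX|uvX]].
- rewrite mem_vline_F2 => /orP[]/eqP-> ->; last by rewrite addrK_F2; right.
  by rewrite addr0; left.
- by exists u => //; exists 0; rewrite ?mem0v ?addr0.
- by exists (u + v) => //; exists v; rewrite ?memv_line ?addrK_F2.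
Qed.

Lemma exists_notin (X : {vspace V}) : (\dim X < k)%N -> exists z, z \notin X.
Proof.
move=> ltXk; have /subvPn[z _ zX] : ~~ (fullv <= X)%VS; last by exists z.
by apply: contraL ltXk => /dimvS; rewrite dimvf dim_matrix mul1r -leqNgt.
Qed.

Lemma dim_add_vline (X : {vspace V}) v : (\dim (X + <[v]>) <= (\dim X).+1)%N.
Proof.
apply: leq_trans (dimv_add_leqif _ _) _; rewrite dim_vline.
by rewrite -[leqRHS]addn1 leq_add2l leq_b1.
Qed.

(** Each vector is chosen outside the span of [W] and the earlier ones; corrections from [W] then
    set the polar values and [Q] without leaving the coset. *)
Lemma independent_triple : (3 <= \dim W)%N -> exists p q r,
  [/\ [/\ Q p = 0, Q q = 0 & Q r = 0],
      [/\ p \notin W, q \notin W & r \notin W],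
      [/\ p + q \notin W, p + r \notin W & q + r \notin W]
    & [/\ B p q = 1, B p r = 1 & B q r = 1]].
Proof.
move=> W3; have big i : (i < 3)%N -> (\dim W + i < k)%N.
  by move=> i3; rewrite [X in (_ < X)%N]dimW -addnn ltn_add2l (leq_trans i3).
have [p0 p0W] : exists z, z \notin W.
  by apply: exists_notin; rewrite -[X in (X < _)%N]addn0 big.
have [w0 [w0W _ Qp]] : exists w,
    [/\ w \in W, forall u, u \in 0%VS -> B u w = 0 & Q (p0 + w) = 0].
  by apply: singular_translate; rewrite addv0.
set p := p0 + w0 in Qp; have pW : p \notin W by rewrite memv_addl.
have [y [yW _ py]] : exists w,
    [/\ w \in W, forall u, u \in 0%VS -> B u w = 0 & B p w = 1].
  by apply: perp_separation; rewrite addv0.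
have [q0 q0W] : exists z, z \notin (W + <[p]>)%VS.
  apply: exists_notin; apply: leq_ltn_trans (dim_add_vline _ _) _.
  by rewrite -addn1 big.
(* As [B p y = 1], the correction adds 1 to [B p q0] exactly when that value is 0; [w1] below is
   orthogonal to [p] and keeps the result. *)
pose q1 := q0 + (1 + B p q0) *: y.
have q1W : q1 \notin (W + <[p]>)%VS.
  by rewrite memv_addl // memvZ // (subvP (addvSl W _)).
have [w1 [w1W pw1 Qq]] := singular_translate q1W.
set q := q1 + w1 in Qq.
have qWp : q \notin (W + <[p]>)%VS by rewrite memv_addl // (subvP (addvSl W _)).
have pq : B p q = 1.
  rewrite /q /q1 !polarDr polarZr py pw1 ?memv_line // mulr1 addr0.
  by rewrite addrC -addrA F2_addxx addr0.
have [qW qpW] : q \notin W /\ q + p \notin W.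
  by apply/andP; rewrite -negb_or -memv_add_vline.
(* [y1] and [y2] are dual to [p] and [q], so [B p r] and [B q r] can be set independently. *)
have [y1 [y1W qy1 py1]] : exists w,
    [/\ w \in W, forall u, u \in <[q]>%VS -> B u w = 0 & B p w = 1].
  by apply: perp_separation; rewrite memv_add_vline negb_or pW addrC.
have [y2 [y2W py2 qy2]] := perp_separation qWp.
have [r0 r0W] : exists z, z \notin (W + (<[p]> + <[q]>))%VS.
  apply: exists_notin; rewrite addvA; apply: leq_ltn_trans (dim_add_vline _ _) _.
  apply: leq_ltn_trans (_ : \dim W + 2 < k)%N; last exact: big.
  by rewrite addn2 ltnS dim_add_vline.
pose r1 := r0 + ((1 + B p r0) *: y1 + (1 + B q r0) *: y2).
have r1W : r1 \notin (W + (<[p]> + <[q]>))%VS.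
  by rewrite memv_addl // (subvP (addvSl W _)) // memvD // memvZ.
have [w2 [w2W perp_w2 Qr]] := singular_translate r1W.
set r := r1 + w2 in Qr.
have rW : r \notin (W + (<[p]> + <[q]>))%VS.
  by rewrite memv_addl // (subvP (addvSl W _)).
have pr : B p r = 1.
  rewrite /r /r1 !polarDr !polarZr py1 py2 ?memv_line // perp_w2; last first.
    by rewrite (subvP (addvSl _ _)) ?memv_line.
  by rewrite mulr1 mulr0 !addr0 addrC -addrA F2_addxx addr0.
have qr : B q r = 1.
  rewrite /r /r1 !polarDr !polarZr qy2 qy1 ?memv_line // perp_w2; last first.
    by rewrite (subvP (addvSr _ _)) ?memv_line.
  by rewrite mulr1 mulr0 add0r addr0 addrC -addrA F2_addxx addr0.
move: rW; rewrite addvA !memv_add_vline !negb_or => /andP[/andP[rW rpW] /andP[rqW _]].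
exists p, q, r; split; split=> //; first by rewrite addrC.
  by rewrite addrC.
by rewrite addrC.
Qed.

(** * Counting cosets and finding the odd neighbour *)

Lemma card_vspace_F2 (X : {vspace V}) : (#|[set v | v \in X]| <= 2 ^ \dim X)%N.
Proof.
pose f (x : 'rV['F_2]_(\dim X)) := \sum_i x 0 i *: (vbasis X)`_i.
apply: leq_trans (_ : #|f @: setT| <= _)%N.
  apply/subset_leq_card/subsetP=> v; rewrite inE => /coord_vbasis_F2[x ->].
  by apply/imsetP; exists x.
by rewrite (leq_trans (leq_imset_card _ _)) // cardsT card_mx card_Fp // mul1n.
Qed.

(* The hyperplane complement [B z s = 1] has [2 ^ k.-1] elements, each coset
   of [W] has [2 ^ \dim W]. *)
Lemma avoid_cosets s (cs : seq V) : s != 0 ->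
  ((size cs * 2 ^ \dim W).*2 < 2 ^ k)%N ->
  exists2 z, B z s = 1 & all (fun c => z + c \notin W) cs.
Proof.
move=> s0 small; have [y ys] : exists y, B y s = 1.
  have /existsP[y] : [exists y, B y s != 0]; last by exists y; apply: F2_neq0.
  apply: contraNT s0 => /existsPn no; apply/eqP/polar_nondegenerate => u.
  by apply/eqP/negPn.
pose A := [set z : V | B z s == 0].
pose D := [set z : V | has (fun c => z + c \in W) cs].
have cardA : (#|A|.*2 <= 2 ^ k)%N.
  have -> : (2 ^ k)%N = #|{: V}| by rewrite card_mx card_Fp // mul1n.
  (* Translation by [y] carries [A] into its complement, because [B y s = 1]. *)
  rewrite -(cardsC A) -addnn leq_add2l -(card_imset A (addIr y)).
  apply/subset_leq_card/subsetP=> _ /imsetP[z + ->].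
  by rewrite !inE polarDl ys => /eqP->; rewrite add0r oner_eq0.
have cardD : (#|D| <= size cs * 2 ^ \dim W)%N.
  rewrite {}/D {small}; elim: cs => [|c cs IH] /=.
    by rewrite leqn0 cards_eq0; apply/eqP/setP=> z; rewrite !inE.
  rewrite (_ : [set z | _] = [set z | z + c \in W] :|:
    [set z : V | has (fun c => z + c \in W) cs]); last by apply/setP=> z; rewrite !inE.
  rewrite mulSn; apply: leq_trans (leq_card_setU _ _) (leq_add _ IH).
  apply: leq_trans (card_vspace_F2 W); rewrite -(card_imset _ (addIr c)).
  by apply/subset_leq_card/subsetP=> _ /imsetP[z + ->]; rewrite !inE.
have /subsetPn[z _] : ~~ ([set: V] \subset A :|: D).
  apply: contraTN small => /subset_leq_card; rewrite cardsT card_mx card_Fp // mul1n.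
  move=> le; have := leq_trans le (leq_card_setU A D).
  move: cardA cardD; set a := (2 ^ k)%N; set b := (_ * _)%N; lia.
rewrite !inE negb_or -all_predC => /andP[zA zD]; exists z => //.
exact: F2_neq0.
Qed.


(** The last sum is [B z s] for [s = p + q + r + t], so [z] is sought off the hyperplane orthogonal
    to [s], then made singular. *)
Lemma odd_neighbour p q r t : (4 <= \dim W)%N -> Q (p + q + r) = 1 -> Q t = 0 ->
  exists z, [/\ Q z = 0, z \notin W,
    [/\ z + p \notin W, z + q \notin W, z + r \notin W & z + t \notin W]
    & B z p + B z q + B z r + B z t = 1].
Proof.
move=> W4 Qpqr Qt; pose s := p + q + r + t.
have s0 : s != 0.
  by rewrite addr_eq0_F2; apply: contra_eq_neq Qpqr => ->; rewrite Qt.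
(* [12 * 2 ^ \dim W < 4 ^ \dim W] needs [2 ^ \dim W > 12], hence the bound 4 on [\dim W]. *)
have small : ((6 * 2 ^ \dim W).*2 < 2 ^ k)%N.
  have -> : (2 ^ k = 2 ^ \dim W * 2 ^ \dim W)%N by rewrite -expnD addnn -dimW.
  rewrite -muln2 mulnAC ltn_pmul2r ?expn_gt0 //.
  by apply: leq_trans (leq_pexp2l _ W4).
(* The entries [0] and [s] together keep [z0] out of [W + <[s]>], so that it can be made singular
   without changing [B z0 s]. *)
have [z0 z0s /and5P[z0W z0p z0q z0r /and3P[z0t z0s' _]]] :=
  @avoid_cosets s [:: 0; p; q; r; t; s] s0 small.
rewrite addr0 in z0W.
have [w [wW sw Qz]] : exists w, [/\ w \in W,
    forall u, u \in <[s]>%VS -> B u w = 0 & Q (z0 + w) = 0].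
  by apply: singular_translate; rewrite memv_add_vline negb_or z0W.
have shiftW c : (z0 + w + c \in W) = (z0 + c \in W).
  by rewrite addrAC memv_addl.
exists (z0 + w); split; rewrite ?shiftW //; first by rewrite memv_addl.
by rewrite -!polarDr polarDl z0s polarC sw ?memv_line ?addr0.
Qed.

(** * Vertices as vectors, adjacency as a polar value *)

Lemma vpick_vline v : v != 0 -> vpick <[v]>%VS = v.
Proof.
move=> v0; have /is_point_vpick[_] : is_point <[v]>%VS by rewrite is_point_vline.
by move/esym/vline_inj_F2; apply.
Qed.

(** A point over ['F_2] has a single nonzero vector, so [vpick] involves no choice. *)
Definition NO_vec (x : NO_vertex Q) : V := vpick (val x).
Definition G_vec (x : G_vertex Q W) : V := vpick (val x).

Lemma NO_vecP (x : NO_vertex Q) : Q (NO_vec x) = 1 /\ val x = <[NO_vec x]>%VS.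
Proof.
have /andP[/is_point_vpick[x0 xE]] := valP x; rewrite xE quadric_vline x0.
by move/F2_neq0.
Qed.

Lemma G_vecP (x : G_vertex Q W) : [/\ G_vec x != 0, Q (G_vec x) = 0,
  G_vec x \notin W & val x = <[G_vec x]>%VS].
Proof.
have /andP[Qx xW] := valP x; have /andP[/is_point_vpick[x0 xE] _] := Qx.
by move: Qx xW; rewrite xE quadric_vline x0 -memvE => /eqP.
Qed.

Lemma NO_vec_inj : injective NO_vec.
Proof. by move=> x y xy; apply/val_inj; rewrite (NO_vecP x).2 xy -(NO_vecP y).2. Qed.

Lemma NO_vec_surj v : Q v = 1 -> exists x, NO_vec x = v.
Proof.
move=> Qv; have v0 : v != 0 by apply: contra_eq_neq Qv => ->; rewrite quad0.
have vP : is_point <[v]>%VS && (<[v]>%VS \notin quadric Q).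
  by rewrite is_point_vline quadric_vline v0 Qv.
by exists (Sub <[v]>%VS vP); rewrite /NO_vec SubK vpick_vline.
Qed.

Lemma G_vec_surj v : Q v = 0 -> v \notin W -> exists x, G_vec x = v.
Proof.
move=> Qv vW; have v0 : v != 0 by apply: contraNneq vW => ->; apply: mem0v.
have vP : (<[v]>%VS \in quadric Q) && ~~ (<[v]> <= W)%VS.
  by rewrite quadric_vline v0 Qv -memvE vW.
by exists (Sub <[v]>%VS vP); rewrite /G_vec SubK vpick_vline.
Qed.

Lemma NO_adjE (x y : NO_vertex Q) : x <> y ->
  NO_adj x y <-> B (NO_vec x) (NO_vec y) = 0.
Proof.
move=> xy; have xyV : NO_vec x != NO_vec y by apply/eqP=> /NO_vec_inj.
rewrite /NO_adj (NO_vecP x).2 (NO_vecP y).2.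
by rewrite tangent_line ?(NO_vecP x).1 ?(NO_vecP y).1 //; split=> [[]|].
Qed.

(** The third point of the line lies outside [W], so the line misses [W] and only the secant case
    remains. *)
Lemma G_adjE (x y : G_vertex Q W) : G_vec x + G_vec y \notin W ->
  G_adj x y <-> B (G_vec x) (G_vec y) = 1.
Proof.
move=> xyW; have xyV : G_vec x != G_vec y.
  by apply: contraNneq xyW => ->; rewrite addrr_F2 mem0v.
have xy : x <> y by move=> xy; rewrite xy eqxx in xyV.
rewrite /G_adj; have [x0 Qx xW ->] := G_vecP x.
have [y0 Qy yW ->] := G_vecP y; rewrite secant_line // line_cap_point //.
by rewrite (negPf xyW); split=> [[_ [|[]]]|] //; split=> //; left.
Qed.

End PointsF2.

(* The equivalence of equivalences says that an even number of [x], [y], [z],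
   [t] are adjacent to [v]. *)
Definition even_completions (G : sgraph) : Prop :=
  forall x y z : vertex G, adj x y -> adj x z -> adj y z ->
  exists t, forall v, v <> x -> v <> y -> v <> z -> v <> t ->
    (adj v x <-> adj v y) <-> (adj v z <-> adj v t).

(** * Parity in the two graphs *)

Lemma even_completions_iso (G H : sgraph) :
  graph_isomorphic G H -> even_completions H -> even_completions G.
Proof.
case=> f [[g fK gK] fE] evH x y z xy xz yz.
have [||| t tP] := evH (f x) (f y) (f z); try exact/fE.
exists (g t) => v vx vy vz vt; rewrite !fE gK; apply: tP;
  by [move/(can_inj fK) | move=> vt'; apply: vt; rewrite -vt' fK].
Qed.

Lemma NO_even_completions k (Q : 'rV['F_2]_k -> 'F_2) :
  quadratic_form Q -> even_completions (NO_graph Q).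
Proof.
move=> quadQ x y z xy xz yz.
have [Qx _] := NO_vecP quadQ x; have [Qy _] := NO_vecP quadQ y; have [Qz _] := NO_vecP quadQ z.
have perp (u v : NO_vertex Q) : NO_adj u v -> polar Q (NO_vec u) (NO_vec v) = 0.
  by move=> uv; apply: (NO_adjE quadQ (proj1 uv)).1.
(* Pairwise orthogonality leaves [Q] equal to [1 + 1 + 1 = 1] on the sum, so it is a vertex. *)
have [t tE] : exists t : NO_vertex Q, NO_vec t = NO_vec x + NO_vec y + NO_vec z.
  apply: NO_vec_surj => //; rewrite !quadD // polarDl // !perp // Qx Qy Qz.
  exact/val_inj.
exists t => v vx vy vz vt; rewrite /= !(NO_adjE quadQ) // tE !polarDr //.
by apply/F2_parity; rewrite F2_addxx.
Qed.

Lemma G_not_even_completions k (Q : 'rV['F_2]_k -> 'F_2)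
    (W : {vspace 'rV['F_2]_k}) :
  quadratic_form Q -> Defs.nondegenerate Q -> contained Q W ->
  k = (\dim W).*2 -> (4 <= \dim W)%N -> ~ even_completions (G_graph Q W).
Proof.
move=> quadQ ndQ cW dimW W4 evG.
have [p [q [r [[Qp Qq Qr] [pW qW rW] [pqW prW qrW] [pq pr qr]]]]] :=
  independent_triple quadQ ndQ cW dimW (ltnW W4).
have Qpqr : Q (p + q + r) = 1.
  by rewrite !quadD // polarDl // Qp Qq Qr pq pr qr; apply/val_inj.
have [x xE] := G_vec_surj quadQ Qp pW; have [y yE] := G_vec_surj quadQ Qq qW.
have [z zE] := G_vec_surj quadQ Qr rW.
have [|||t tP] := evG x y z; try by apply: (G_adjE quadQ _).2; rewrite ?xE ?yE ?zE.
have [_ Qt _ _] := G_vecP quadQ t.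
have [u [Qu uW [upW uqW urW utW] odd]] :=
  odd_neighbour quadQ ndQ cW dimW W4 Qpqr Qt.
have [v vE] := G_vec_surj quadQ Qu uW.
(* Lying in different cosets also gives distinctness, as [u + u = 0] is in [W]. *)
have neq (a : G_vertex Q W) : u + G_vec a \notin W -> v <> a.
  by move=> + va; rewrite -va vE addrr_F2 mem0v.
have := tP v (neq x _) (neq y _) (neq z _) (neq t utW).
rewrite xE yE zE => /(_ upW uqW urW).
rewrite /= !(G_adjE quadQ) ?vE ?xE ?yE ?zE // => /F2_parity.
by rewrite odd.
Qed.

Theorem theorem4p15 (n : nat) (hn : (3 <= n)%N)
    (Q : 'rV['F_2]_(2 * n + 2) -> 'F_2) (hQ : hyperbolic_form Q)
    (Pi : {vspace 'rV['F_2]_(2 * n + 2)}) (hPi : generator Q Pi) :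
  ~ graph_isomorphic (G_graph Q Pi) (NO_graph Q).
Proof.
move=> iso; have [quadQ ndQ _] := hQ; have [dimPi cPi] := hPi.
have evG := even_completions_iso iso (NO_even_completions quadQ).
(* [Pi] has vector dimension [n.+1], so [3 <= n] gives the bound 4, and [2 * n + 2] is twice this
   dimension. *)
apply: (G_not_even_completions quadQ ndQ cPi) evG; rewrite dimPi //.
by rewrite doubleS addn2 mul2n.
Qed.
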